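(* Let $(X_i,\mathcal A_i,\nu_i)$, $i=1,2$, be $\sigma$-finite standard measure spaces, and let $R$ be a symmetric positive operator in $L^2(\nu_1)$ satisfying assumptions (i)--(iv) of the context, with Friedrichs extension $\widehat R$. Let the kernels $P$ and $Q$ be defined, by means of $R$, the orthonormal basis $(\widehat k_n)$ of $\mathcal H(\lambda_1)$ and the orthonormal basis $(\varphi_n)$ of $L^2(\nu_2)$ described in the context, by $$Q(y,A)=\sum_{n=1}^\infty\widehat k_n(A)\varphi_n(y),\quad A\in\mathcal D(\nu_1),\qquad P(x,B)=\sum_{n=1}^\infty\Big(\int_B\varphi_n\,d\nu_2\Big)R(f_n)(x),\quad B\in\mathcal D(\nu_2).$$ Then $\widehat R=T_PT_Q$, i.e. the corresponding operators $T_P$ and $T_Q$ factorize the operator $\widehat R:L^2(\nu_1)\to L^2(\nu_1)$.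
   Context: All spaces are real. $\mathcal D(\nu_i)=\{A\in\mathcal A_i:\nu_i(A)<\infty\}$, and $\mathcal F(\nu_i)$ is the linear span of $\{\chi_A:A\in\mathcal D(\nu_i)\}$. Assumptions on $R$: (i) $R$ is a densely defined (in general unbounded) operator in $L^2(\nu_1)$ with $\mathcal F(\nu_1)\subset Dom(R)$ and $R(\mathcal F(\nu_1))\subset L^2(\nu_1)$; (ii) $R$ is symmetric and positive, i.e. $R(f)\ge0$ whenever $f\ge0$; (iii) $R$ is positive definite, i.e. $\langle R(f),f\rangle_{L^2(\nu_1)}\ge0$; (iv) the kernel of $R$ is trivial. $\lambda_1$ is the symmetric measure on $X_1\times X_1$ with $\lambda_1(A\times B)=\langle\chi_A,R(\chi_B)\rangle_{L^2(\nu_1)}$ for $A,B\in\mathcal D(\nu_1)$. $\mathcal H(\lambda_1)$ is the reproducing kernel Hilbert space of functions on $\mathcal D(\nu_1)$ generated by the positive definite function $K(A,B)=\lambda_1(A\times B)$; its elements have the form $\widehat f(A)=\langle R(\chi_A),f\rangle_{L^2(\nu_1)}$ with $f\in Dom(\widehat R^{1/2})$, and $\|\widehat f\|_{\mathcal H(\lambda_1)}=\|\widehat R^{1/2}f\|_{L^2(\nu_1)}$. $(\widehat k_n)$ is an orthonormal basis of $\mathcal H(\lambda_1)$, with functions $f_n\in Dom(\widehat R^{1/2})\subset L^2(\nu_1)$, chosen such that $R(f_n)$ is defined, satisfying $\widehat k_n(A)=\langle R(\chi_A),f_n\rangle_{L^2(\nu_1)}=\langle\chi_A,R(f_n)\rangle_{L^2(\nu_1)}$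 for $A\in\mathcal D(\nu_1)$; $(\varphi_n)$ is an orthonormal basis of $L^2(\nu_2)$. The two bases are taken to be formed by non-negative functions: $f_n\ge0$ and $\varphi_n\ge0$. The operators are $T_Q(f)(y)=\int_{X_1}Q(y,dx)f(x)=\sum_n\langle f,R(f_n)\rangle_{L^2(\nu_1)}\varphi_n(y)$, from $L^2(\nu_1)$ to $L^2(\nu_2)$ with $\mathcal F(\nu_1)$ in its domain, and $T_P(g)(x)=\int_{X_2}P(x,dy)g(y)=\sum_n\langle g,\varphi_n\rangle_{L^2(\nu_2)}R(f_n)(x)$, from $L^2(\nu_2)$ to $L^2(\nu_1)$ with $\mathcal F(\nu_2)$ in its domain; in general both are unbounded and densely defined.
   Formalization: The domains of T_Q and T_P, left open here, are fixed: T_Q is the integral operator of Q on the domain of the square root of the Friedrichs extension, T_P that of P on the domain of the adjoint of T_Q; with maximal domains T_P T_Q can properly extend the Friedrichs extension. *)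

(* Defs.v *)
From HB Require Import structures.
From mathcomp Require Import all_boot all_order all_algebra.
From mathcomp Require Import all_classical all_reals all_analysis.
From mathcomp Require Import measurable_realfun.

Set Implicit Arguments.
Unset Strict Implicit.
Unset Printing Implicit Defensive.

Import Order.TTheory GRing.Theory Num.Theory.
Import numFieldNormedType.Exports.

Local Open Scope classical_set_scope.
Local Open Scope ring_scope.

(* A Borel space isomorphic to a Polish space with its Borel sets. *)
Definition standard_borel (R : realType) d (X : measurableType d) : Prop :=
  exists (P : completePseudoMetricType R) (phi : X -> P),
    [/\ hausdorff_space P, @second_countable P, bijective phi &
        forall A : set X, measurable A <-> <<s @open P >> (phi @` A)].

(* Elements of L^2(mu) are represented by square-integrable functions; they
   are identified only through "= %[ae mu]", never through Leibniz equality. *)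
Notation L2 mu := (LfunType mu (lee1n 2)).

Section L2.
Context (R : realType) d (X : measurableType d) (mu : {measure set X -> \bar R}).

Definition dot (f g : L2 mu) : R := Rintegral mu setT (fun x => f x * g x).

Definition ae_nonneg (f : L2 mu) : Prop := {ae mu, forall x, 0 <= f x}.

Definition is_onb_L2 (phi : nat -> L2 mu) : Prop :=
  (forall m n, dot (phi m) (phi n) = (m == n)%:R) /\
  (forall g : L2 mu, (forall n, dot g (phi n) = 0) -> g = (0 : L2 mu) %[ae mu]).

Structure Dfin := MkDfin {
  Dset :> set X;
  Dset_measurable : measurable Dset;
  Dset_fin : (mu Dset < +oo)%E }.

Lemma indic_Lfun (A : Dfin) : (\1_(Dset A) : X -> R) \in Lfun mu 2%:E.
Proof.
have mA := Dset_measurable A.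
rewrite inE; apply/andP; split; rewrite inE/=; first exact: measurable_indic.
rewrite /finite_norm unlock /Lnorm; apply: poweR_lty.
under eq_integral => x _.
  rewrite (_ : _ `^ _ = (\1_(Dset A) x)%:E)%E; last first.
    rewrite /= indicE; case: (x \in _).
      by rewrite normr1 powR1.
    by rewrite normr0 powR0// pnatr_eq0.
  over.
by rewrite integral_indic// setIT; exact: Dset_fin.
Qed.

Definition chi (A : Dfin) : L2 mu := Lfun_Sub (lee1n 2) (indic_Lfun A).

(* the space F(mu) *)
Definition Fspan : set (L2 mu) :=
  [set f | exists (n : nat) (a : 'I_n -> R) (A : 'I_n -> Dfin),
             f = \sum_(i < n) a i *: chi (A i)].

End L2.
Arguments Fspan {R d X} mu.

(* A partially defined operator; the values of [app] outside [dom] are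
   irrelevant. *)
Structure L2op (R : realType) d1 (X1 : measurableType d1)
    (mu1 : {measure set X1 -> \bar R}) d2 (X2 : measurableType d2)
    (mu2 : {measure set X2 -> \bar R}) := MkL2op {
  dom : set (L2 mu1);
  app :> L2 mu1 -> L2 mu2 }.

Section operators.
Context (R : realType).
Context d1 (X1 : measurableType d1) (mu1 : {measure set X1 -> \bar R}).
Context d2 (X2 : measurableType d2) (mu2 : {measure set X2 -> \bar R}).
Implicit Types S T : L2op mu1 mu2.

Definition is_linear_op T : Prop :=
  [/\ forall f g : L2 mu1, f = g %[ae mu1] -> dom T f ->
        dom T g /\ T f = T g %[ae mu2],
      dom T 0 &
      forall (a : R) (f g : L2 mu1), dom T f -> dom T g ->
        dom T (a *: f + g) /\ T (a *: f + g) = (a *: T f + T g : L2 mu2) %[ae mu2]].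

Definition densely_defined T : Prop :=
  forall (f : L2 mu1) (e : R), 0 < e ->
    exists2 g, dom T g & dot (f - g) (f - g) < e.

Definition op_eq S T : Prop :=
  dom S = dom T /\ forall f, dom S f -> S f = T f %[ae mu2].

Definition op_restrict T (D : set (L2 mu1)) : L2op mu1 mu2 :=
  MkL2op (dom T `&` D) T.

Definition is_adjoint_val T (g : L2 mu2) (h : L2 mu1) : Prop :=
  forall f, dom T f -> dot (T f) g = dot f h.

(* For densely defined T the value of the adjoint is unique a.e. *)
Definition adjoint T : L2op mu2 mu1 :=
  MkL2op [set g | exists h, is_adjoint_val T g h]
         (fun g => xget 0 [set h | is_adjoint_val T g h]).

End operators.

Definition op_comp (R : realType)
    d1 (X1 : measurableType d1) (mu1 : {measure set X1 -> \bar R})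
    d2 (X2 : measurableType d2) (mu2 : {measure set X2 -> \bar R})
    d3 (X3 : measurableType d3) (mu3 : {measure set X3 -> \bar R})
    (S : L2op mu2 mu3) (T : L2op mu1 mu2) : L2op mu1 mu3 :=
  MkL2op [set f | dom T f /\ dom S (T f)] (fun f => S (T f)).

Section symmetric_operators.
Context (R : realType) d (X : measurableType d) (mu : {measure set X -> \bar R}).
Implicit Types S T : L2op mu mu.

Definition symmetric_op T : Prop :=
  forall f g, dom T f -> dom T g -> dot (T f) g = dot f (T g).

Definition nonneg_preserving T : Prop :=
  forall f, dom T f -> ae_nonneg f -> ae_nonneg (T f).

Definition positive_definite_op T : Prop :=
  forall f, dom T f -> 0 <= dot (T f) f.

Definition trivial_kernel T : Prop :=
  forall f, dom T f -> T f = (0 : L2 mu) %[ae mu] -> f = (0 : L2 mu) %[ae mu].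

Definition self_adjoint T : Prop := densely_defined T /\ op_eq T (adjoint T).

(* Domain of the closure of the form f, g |-> <T f, g>. *)
Definition form_dom T : set (L2 mu) :=
  [set f | exists u : nat -> L2 mu,
    [/\ forall n, dom T (u n),
        (fun n => dot (u n - f) (u n - f)) @ \oo --> (0 : R) &
        forall e : R, 0 < e -> exists N : nat, forall m n : nat,
          (N <= m)%N -> (N <= n)%N ->
          dot (T (u m - u n)) (u m - u n) < e]].

(* Friedrichs extension: the restriction of T^* to dom T^* /\ form_dom T. *)
Definition friedrichs T : L2op mu mu :=
  op_restrict (adjoint T) (form_dom T).

(* S = T^{1/2}, the positive self-adjoint square root (unique if it exists). *)
Definition is_sqrt_op S T : Prop :=
  [/\ self_adjoint S, positive_definite_op S & op_eq (op_comp S S) T].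

(* The function A |-> <T(chi_A), f> on D(mu). *)
Definition hat T (f : L2 mu) (A : Dfin mu) : R := dot (T (chi A)) f.

End symmetric_operators.

(* Hilbert space (H, ip) of functions on D with reproducing kernel K; by the
   Moore-Aronszajn theorem it is uniquely determined by K. *)
Structure is_rkhs (R : realType) (D : Type) (K : D -> D -> R)
    (H : set (D -> R)) (ip : (D -> R) -> (D -> R) -> R) : Prop := MkIsRkhs {
  rkhs_0 : H (fun=> 0);
  rkhs_lin : forall (a : R) f g, H f -> H g -> H (fun x => a * f x + g x);
  rkhs_ipC : forall f g, H f -> H g -> ip f g = ip g f;
  rkhs_ip_lin : forall (a : R) f g h, H f -> H g -> H h ->
    ip (fun x => a * f x + g x) h = a * ip f h + ip g h;
  rkhs_ip_ge0 : forall f, H f -> 0 <= ip f f;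
  rkhs_ip_eq0 : forall f, H f -> ip f f = 0 -> f = (fun=> 0);
  rkhs_complete : forall u : nat -> D -> R, (forall n, H (u n)) ->
    (forall e : R, 0 < e -> exists N : nat, forall m n : nat,
       (N <= m)%N -> (N <= n)%N ->
       ip (fun x => u m x - u n x) (fun x => u m x - u n x) < e) ->
    exists2 f, H f &
      (fun n => ip (fun x => u n x - f x) (fun x => u n x - f x)) @ \oo
        --> (0 : R);
  rkhs_kernel : forall x, H (K x);
  rkhs_reproducing : forall f x, H f -> ip f (K x) = f x }.

Definition is_onb_rkhs (R : realType) (D : Type)
    (H : set (D -> R)) (ip : (D -> R) -> (D -> R) -> R)
    (k : nat -> D -> R) : Prop :=
  [/\ forall n, H (k n),
      forall m n, ip (k m) (k n) = (m == n)%:R &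
      forall f, H f -> (forall n, ip f (k n) = 0) -> f = (fun=> 0)].

Section kernel_operators.
Context (R : realType).
Context d1 (X1 : measurableType d1) (mu1 : {measure set X1 -> \bar R}).
Context d2 (X2 : measurableType d2) (mu2 : {measure set X2 -> \bar R}).

Definition is_kernel_val (k : R.-ker X2 ~> X1) (f : L2 mu1) (g : L2 mu2) : Prop :=
  {ae mu2, forall y, (k y).-integrable setT (EFin \o f) /\
                     (g y)%:E = (\int[k y]_x (f x)%:E)%E}.

(* f |-> (y |-> \int k(y,dx) f(x)) on its maximal domain in L^2(mu1). *)
Definition kernel_op (k : R.-ker X2 ~> X1) : L2op mu1 mu2 :=
  MkL2op [set f | exists g, is_kernel_val k f g]
         (fun f => xget 0 [set g | is_kernel_val k f g]).

End kernel_operators.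
Arguments kernel_op {R d1 X1} mu1 {d2 X2} mu2 k.

Section factors.
Context (R : realType).
Context d1 (X1 : measurableType d1) (nu1 : {measure set X1 -> \bar R}).
Context d2 (X2 : measurableType d2) (nu2 : {measure set X2 -> \bar R}).

(* The values are those of the kernel integrals; the point is the choice of
   domains.  Rh is the square root of the Friedrichs extension Rhat of R.
   T_Q is taken on Dom(Rh), where its coefficients <f, R(f_n)> are the
   coordinates of [hat R f] in H(lambda_1); T_P is taken on those g for which
   T_P(g) is dual to T_Q.  With the maximal domains the composition extends
   Rhat, and the extension can be proper. *)
Definition T_Q (Rh : L2op nu1 nu1) (Q : R.-ker X2 ~> X1) : L2op nu1 nu2 :=
  op_restrict (kernel_op nu1 nu2 Q) (dom Rh).

Definition T_P (Rh : L2op nu1 nu1) (Q : R.-ker X2 ~> X1) (P : R.-ker X1 ~> X2) :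
    L2op nu2 nu1 :=
  op_restrict (kernel_op nu2 nu1 P) (dom (adjoint (T_Q Rh Q))).

End factors.
Arguments T_Q {R d1 X1 nu1 d2 X2} nu2 Rh Q.
Arguments T_P {R d1 X1 nu1 d2 X2} nu2 Rh Q P.

(* Main.v *)
(* Write S for the square root of the Friedrichs extension and w_n := R(f_n).
   For f in Dom(S) the numbers <f, w_n> = <S f, S f_n> are the coordinates of
   [hat R f] in the basis (k_n), so Parseval's identity in H(lambda_1) gives
   sum_n <f, w_n>^2 = |S f|^2.  Hence T_Q f = sum_n <f, w_n> phi_n is defined on
   all of Dom(S) and <T_Q f, T_Q g> = <S f, S g>.  On the other hand, T_P is the
   adjoint of T_Q on its domain, as both have the same integral over every set
   of finite measure.  Therefore T_P T_Q = T_Q^* T_Q = S S. *)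

Require Import Defs.
From HB Require Import structures.
From mathcomp Require Import all_boot all_order all_algebra.
From mathcomp Require Import all_classical all_reals all_analysis.
From mathcomp Require Import ring lra measurable_realfun.

Set Implicit Arguments.
Unset Strict Implicit.
Unset Printing Implicit Defensive.

Import Order.TTheory GRing.Theory Num.Theory.
Import numFieldNormedType.Exports.

Local Open Scope classical_set_scope.
Local Open Scope ring_scope.

(** * The inner product on square-integrable functions *)

Section L2_theory.
Context (R : realType) d (X : measurableType d).
Context (mu : {measure set X -> \bar R}).
Implicit Types f g h : L2 mu.

Lemma L2_mul_integrable f g :
  mu.-integrable setT (fun x => (f x * g x)%:E).
Proof. by apply/Lfun1_integrable/Lfun2_mul_Lfun1; exact: LfunP. Qed.

Lemma measurable_L2 f : measurable_fun setT f.
Proof. exact: measurable_funPT. Qed.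

Lemma EFin_dot f g : (dot f g)%:E = (\int[mu]_x (f x * g x)%:E)%E.
Proof.
rewrite /dot /Rintegral fineK//; apply: integrable_fin_num => //.
exact: L2_mul_integrable.
Qed.

Lemma dotC f g : dot f g = dot g f.
Proof. by apply: eq_Rintegral => x _; rewrite mulrC. Qed.

Lemma dotDl f g h : dot (f + g) h = dot f h + dot g h.
Proof.
rewrite -[RHS]RintegralD//; [|exact: L2_mul_integrable..].
by apply: eq_Rintegral => x _; rewrite -mulrDl.
Qed.

Lemma dotZl (a : R) f h : dot (a *: f) h = a * dot f h.
Proof.
rewrite -[RHS]RintegralZl//; last exact: L2_mul_integrable.
by apply: eq_Rintegral => x _; rewrite mulrA.
Qed.

Lemma dotNl f h : dot (- f) h = - dot f h.
Proof. by rewrite -scaleN1r dotZl mulN1r. Qed.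

Lemma dotBl f g h : dot (f - g) h = dot f h - dot g h.
Proof. by rewrite dotDl dotNl. Qed.

Lemma dotDr f g h : dot f (g + h) = dot f g + dot f h.
Proof. by rewrite dotC dotDl !(dotC f). Qed.

Lemma dotBr f g h : dot f (g - h) = dot f g - dot f h.
Proof. by rewrite dotC dotBl !(dotC f). Qed.

Lemma dot0l f : dot 0 f = 0.
Proof. by rewrite -(scale0r f) dotZl mul0r. Qed.

Lemma eq_dotl f g h : f = g %[ae mu] -> dot f h = dot g h.
Proof.
move=> fg; congr fine; apply: ae_eq_integral => //.
- exact: measurable_int (L2_mul_integrable _ _).
- exact: measurable_int (L2_mul_integrable _ _).
- by apply: filterS fg => x /= fgx _; rewrite fgx.
Qed.

Lemma eq_dotr f g h : g = h %[ae mu] -> dot f g = dot f h.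
Proof. by move=> gh; rewrite !(dotC f); exact: eq_dotl. Qed.

Lemma dot_ge0 f g : (forall x, 0 <= f x) -> (forall x, 0 <= g x) -> 0 <= dot f g.
Proof. by move=> f0 g0; apply: Rintegral_ge0 => x _; rewrite mulr_ge0. Qed.

Lemma dot_self_eq0 f : dot f f = 0 -> f = 0 %[ae mu].
Proof.
move=> ff0; have := EFin_dot f f; rewrite ff0 => /esym.
rewrite (_ : (fun x => _) = (fun x => `|(f x * f x)%:E|%E)); last first.
  by apply/funext => x; rewrite gee0_abs// lee_fin -expr2 sqr_ge0.
move/ae_eq_integral_abs.
move=> /(_ measurableT (measurable_int _ (L2_mul_integrable f f))).
apply: filterS => x /= /(_ I) [] /eqP.
by rewrite mulf_eq0 orbb => /eqP.
Qed.

End L2_theory.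

(** * Adjoints and self-adjoint operators *)

Section adjoint_theory.
Context (R : realType).
Context d1 (X1 : measurableType d1) (mu1 : {measure set X1 -> \bar R}).
Context d2 (X2 : measurableType d2) (mu2 : {measure set X2 -> \bar R}).
Implicit Types T : L2op mu1 mu2.

(** The difference [u] of [g] and [h] is orthogonal to the domain, so for [f] in the domain |u -
    f|^2 = |u|^2 + |f|^2 >= |u|^2. Density makes the left side arbitrarily small. *)
Lemma dense_dot_inj T (g h : L2 mu1) : densely_defined T ->
  (forall f, dom T f -> dot f g = dot f h) -> g = h %[ae mu1].
Proof.
move=> Td gh; set u := g - h.
have uu : dot u u <= 0.
  apply/ler_addgt0Pl => e e0; rewrite addr0.
  have [f Tf fu] := Td u e e0; apply/ltW/(le_lt_trans _ fu).
  have fu0 : dot f u = 0 by rewrite /u dotBr gh// subrr.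
  rewrite dotBl (dotBr u) (dotBr f) (dotC u f) fu0 subr0 sub0r opprK lerDl.
  by apply: Rintegral_ge0 => x _; rewrite -expr2 sqr_ge0.
have /dot_self_eq0 : dot u u = 0.
  apply/eqP; rewrite eq_le uu/=.
  by apply: Rintegral_ge0 => x _; rewrite -expr2 sqr_ge0.
by apply: filterS => x /= /(_ I)/eqP + _; rewrite /u subr_eq0 => /eqP.
Qed.

Lemma adjointP T g : dom (adjoint T) g -> is_adjoint_val T g (adjoint T g).
Proof.
by case=> h gh; apply: (@xgetPex _ _ [set h | is_adjoint_val T g h]); exists h.
Qed.

Lemma adjointE T g h : densely_defined T -> is_adjoint_val T g h ->
  adjoint T g = h %[ae mu1].
Proof.
move=> Td gh; apply: (dense_dot_inj Td) => f Tf.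
by rewrite -gh// -adjointP//; exists h.
Qed.

End adjoint_theory.

Section self_adjoint_theory.
Context (R : realType) d (X : measurableType d).
Context (mu : {measure set X -> \bar R}) (S : L2op mu mu).
Hypothesis Ssa : self_adjoint S.

Lemma self_adjoint_dot f g : dom S f -> dom S g -> dot (S f) g = dot f (S g).
Proof.
case: Ssa => _ [dS SE] Sf Sg; have Sg' : dom (adjoint S) g by rewrite -dS.
by rewrite (adjointP Sg' Sf); apply: eq_dotr; apply: ae_eq_sym; exact: SE.
Qed.

(** The main way to prove membership in [dom S]: duality puts [g] in the domain of the adjoint,
    which is [dom S], and density determines the value. *)
Lemma self_adjointP g h : (forall f, dom S f -> dot (S f) g = dot f h) ->
  dom S g /\ S g = h %[ae mu].
Proof.
case: Ssa => Sd [dS SE] gh; have Sg : dom S g by rewrite dS; exists h.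
split=> //; apply: (dense_dot_inj Sd) => f Sf.
by rewrite -self_adjoint_dot// gh.
Qed.

(** Linearity is not part of [self_adjoint]; additivity is recovered from the duality that
    characterizes the values of an adjoint. *)
Lemma self_adjointD f g : dom S f -> dom S g ->
  dom S (f + g) /\ S (f + g) = (S f + S g : L2 mu) %[ae mu].
Proof.
move=> Sf Sg; apply: self_adjointP => h Sh.
by rewrite !dotDr !self_adjoint_dot.
Qed.

Lemma self_adjoint_dotD f g : dom S f -> dom S g ->
  dot (S (f + g)) (S (f + g)) =
  dot (S f) (S f) + 2 * dot (S f) (S g) + dot (S g) (S g).
Proof.
move=> Sf Sg; have [_ SD] := self_adjointD Sf Sg.
rewrite (eq_dotl _ SD) (eq_dotr _ SD) dotDl !dotDr (dotC (S g) (S f)).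
by ring.
Qed.

End self_adjoint_theory.

(** * Operators given by kernels *)

Section kernel_op_theory.
Context (R : realType).
Context d1 (X1 : measurableType d1) (mu1 : {measure set X1 -> \bar R}).
Context d2 (X2 : measurableType d2) (mu2 : {measure set X2 -> \bar R}).
Variable k : R.-ker X2 ~> X1.

Lemma is_kernel_val_inj (f : L2 mu1) (g h : L2 mu2) : is_kernel_val k f g ->
  is_kernel_val k f h -> g = h %[ae mu2].
Proof.
by apply: filterS2 => y [_ fgy] [_ fhy] _; apply: EFin_inj; rewrite fgy fhy.
Qed.

Lemma kernel_opP (f : L2 mu1) : dom (kernel_op mu1 mu2 k) f ->
  is_kernel_val k f (kernel_op mu1 mu2 k f).
Proof.
by case=> g fg; apply: (@xgetPex _ _ [set g | is_kernel_val k f g]); exists g.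
Qed.

Lemma kernel_opE (f : L2 mu1) (g : L2 mu2) : is_kernel_val k f g ->
  kernel_op mu1 mu2 k f = g %[ae mu2].
Proof.
by move=> fg; apply: (is_kernel_val_inj _ fg); apply: kernel_opP; exists g.
Qed.

Lemma is_kernel_valD (f f' : L2 mu1) (g g' : L2 mu2) : is_kernel_val k f g ->
  is_kernel_val k f' g' -> is_kernel_val k (f + f') (g + g').
Proof.
apply: filterS2 => y [fi fg] [f'i f'g]; split.
  by rewrite (_ : EFin \o _ = (EFin \o f) \+ (EFin \o f'))//; exact: integrableD.
by rewrite EFinD fg f'g -integralD.
Qed.

End kernel_op_theory.

(** * Measures determined by sets of finite measure, and measures with a density *)

Lemma eq_measure_sigma_finite d (X : measurableType d) (R : realType)
    (nu : {sigma_finite_measure set X -> \bar R})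
    (m1 m2 : {measure set X -> \bar R}) :
  (forall A, measurable A -> (nu A < +oo)%E -> m1 A = m2 A) ->
  forall A, measurable A -> m1 A = m2 A.
Proof.
move=> m12 A mA; have [F FT /all_and2[mF nuF]] := sigma_finiteT nu.
have mD n : measurable (A `&` seqDU F n).
  by apply: measurableI => //; exact: seqDU_measurable.
(* Cut [A] along a disjoint exhaustion by [nu]-finite sets. Both measures agree on each piece, even
   if they are infinite there. *)
have AE : A = \bigcup_n (A `&` seqDU F n).
  by rewrite -setI_bigcupr -seqDU_bigcup_eq -FT setIT.
have tD : trivIset setT (fun n => A `&` seqDU F n).
  exact/trivIset_setIl/trivIset_seqDU.
rewrite AE !measure_semi_bigcup -?AE//.
apply: eq_eseriesr => n _; apply: m12 => //.
apply: le_lt_trans (nuF n); apply: le_measure; rewrite ?inE//.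
by move=> x [_]; exact: subset_seqDU.
Qed.

Section density.
Context d (X : measurableType d) (R : realType).
Variables (mu : {measure set X -> \bar R}) (u : {mfun X >-> R}).
Local Open Scope ereal_scope.

(** The absolute value makes this a measure for every [u], without a sign condition in the type. It
    is applied to non-negative [u], where it is the measure u dmu. *)
Definition mdensity (A : set X) : \bar R := \int[mu]_(x in A) `|u x|%:E.

Let mu_u D : measurable_fun D (fun x => `|u x|%:E).
Proof.
by apply/measurable_EFinP/measurable_funTS/measurableT_comp.
Qed.

Let mdensity0 : mdensity set0 = 0. Proof. exact: integral_set0. Qed.

Let mdensity_ge0 A : 0 <= mdensity A. Proof. exact: integral_ge0. Qed.

Let mdensity_sigma_additive : semi_sigma_additive mdensity.
Proof.
move=> F mF tF mUF; rewrite /mdensity ge0_integral_bigcup//.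
by apply: is_cvg_ereal_nneg_natsum_cond => n _ _; exact: integral_ge0.
Qed.

HB.instance Definition _ := isMeasure.Build _ _ _ mdensity
  mdensity0 mdensity_ge0 mdensity_sigma_additive.

Import HBNNSimple.

Lemma ge0_integral_mdensity (f : X -> \bar R) : measurable_fun setT f ->
  (forall x, 0 <= f x) -> \int[mdensity]_x f x = \int[mu]_x (f x * `|u x|%:E).
Proof.
move=> mf f0; pose h := nnsfun_approx measurableT mf.
have mh n : measurable_fun setT (EFin \o h n).
  by apply/measurable_EFinP; exact: measurable_funPT.
have hf x : EFin \o h ^~ x @ \oo --> f x by exact: cvg_nnsfun_approx.
have nd_h x : {homo (fun n => (h n x)%:E) : a b / (a <= b)%N >-> a <= b}.
  by move=> a b ab; rewrite lee_fin; exact/lefP/nd_nnsfun_approx.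
have -> : \int[mdensity]_x f x = limn (fun n => \int[mdensity]_x (h n x)%:E).
  under eq_integral => x _ do rewrite -(cvg_lim _ (hf x))//.
  by apply: monotone_convergence => // n x _; rewrite lee_fin.
have -> : \int[mu]_x (f x * `|u x|%:E) =
    limn (fun n => \int[mu]_x ((h n x)%:E * `|u x|%:E)).
  have fE x : f x * `|u x|%:E = limn (fun n => (h n x)%:E * `|u x|%:E).
    by apply/esym/cvg_lim => //; apply: cvgeZr => //; exact: hf.
  under eq_integral do rewrite fE.
  apply: monotone_convergence => //.
  - by move=> n; apply: emeasurable_funM; [exact: mh|exact: mu_u].
  - by move=> n x _; rewrite mule_ge0// lee_fin.
  - by move=> x _ a b ab; rewrite lee_wpmul2r// nd_h.
(* It remains to treat simple functions, as finite sums over their level sets. *)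
congr (limn _); apply/funext => n /=.
rewrite integralT_nnsfun sintegralE.
under [RHS]eq_integral => x _.
  rewrite fimfunE -fsumEFin// ge0_mule_fsuml; last first.
    by move=> y; exact: nnfun_muleindic_ge0.
  over.
rewrite ge0_integral_fsum//; last 2 first.
- move=> y; apply: emeasurable_funM => //.
  by apply/measurable_EFinP; exact: measurable_funM.
- by move=> y x _; rewrite mule_ge0// nnfun_muleindic_ge0.
apply: eq_fsbigr => y; rewrite inE => -[x _ <-].
under eq_integral do rewrite EFinM -muleA.
rewrite ge0_integralZl//; last 2 first.
- by apply: emeasurable_funM; [exact/measurable_EFinP|exact: mu_u].
- by rewrite lee_fin.
congr *%E; rewrite [LHS]integral_mkcond; apply: eq_integral => z _.
by rewrite patchE indicE; case: ifPn; rewrite (mul1e, mul0e).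
Qed.

End density.

(** * Positive and negative parts *)

Section L2_parts.
Context (R : realType) d (X : measurableType d).
Context (mu : {measure set X -> \bar R}).
Implicit Types f g : L2 mu.

Lemma norm_Lfun f : (fun x => `|f x|) \in Lfun mu 2%:E.
Proof.
have := LfunP f; rewrite !inE => /andP[/[!inE]/= mf nf]; apply/andP; split.
  by rewrite inE/=; exact: measurableT_comp.
by rewrite inE/=; move: nf; rewrite /finite_norm -Lnorm_abse.
Qed.

Definition L2norm f : L2 mu := Lfun_Sub (lee1n 2) (norm_Lfun f).

(** Written as a linear combination of |f| and f, so that square-integrability comes from the vector
    space structure. *)
Definition L2pos f : L2 mu := 2^-1 *: (L2norm f + f).

Definition L2neg f : L2 mu := 2^-1 *: (L2norm f - f).

Lemma L2posE f x : L2pos f x = 2^-1 * (`|f x| + f x). Proof. by []. Qed.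

Lemma L2negE f x : L2neg f x = 2^-1 * (`|f x| - f x). Proof. by []. Qed.

Lemma L2pos_ge0 f x : 0 <= L2pos f x.
Proof. by rewrite L2posE mulr_ge0// -lerBlDr sub0r -normrN ler_norm. Qed.

Lemma L2neg_ge0 f x : 0 <= L2neg f x.
Proof. by rewrite L2negE mulr_ge0// subr_ge0 ler_norm. Qed.

Lemma L2posBneg f : L2pos f - L2neg f = f.
Proof.
apply/LfuneqP => x.
by rewrite -[LHS]/(2^-1 * (`|f x| + f x) - 2^-1 * (`|f x| - f x)); field.
Qed.

(** Provides a representative that is non-negative everywhere, as series of extended reals
    require. *)
Lemma L2pos_id f : ae_nonneg f -> L2pos f = f %[ae mu].
Proof.
rewrite /ae_nonneg; apply: filterS => x f0 _.
by rewrite L2posE ger0_norm//; field.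
Qed.

Lemma dot_chi f (A : Dfin mu) :
  (dot (chi A) f)%:E = (\int[mu]_(x in A) (f x)%:E)%E.
Proof.
rewrite EFin_dot [RHS]integral_mkcond; apply: eq_integral => x _ /=.
by rewrite patchE/= indicE; case: ifPn; rewrite (mul1r, mul0r).
Qed.

End L2_parts.

(** * Series of non-negative functions and the measures they define *)

Section integral_series.
Context (R : realType) d (X : measurableType d).
Context (nu : {sigma_finite_measure set X -> \bar R}).
Variables (c : nat -> R) (u : nat -> L2 nu).
Hypothesis c_ge0 : forall n, 0 <= c n.
Hypothesis u_ge0 : forall n x, 0 <= u n x.
Local Open Scope ereal_scope.

Let measurable_term n : measurable_fun setT (fun x => (c n * u n x)%:E).
Proof.
by apply/measurable_EFinP; apply: measurable_funM => //; exact: measurable_L2.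
Qed.

Let term_ge0 n x : 0 <= (c n * u n x)%:E.
Proof. by rewrite lee_fin mulr_ge0. Qed.

Lemma measurable_series :
  measurable_fun setT (fun x => \sum_(n <oo) (c n * u n x)%:E).
Proof. by apply: ge0_emeasurable_sum => // n x _ _; exact: term_ge0. Qed.

Lemma integral_series_mul (v : L2 nu) : (forall x, 0 <= v x)%R ->
  \int[nu]_x ((\sum_(n <oo) (c n * u n x)%:E) * (v x)%:E) =
  \sum_(n <oo) (c n * dot (u n) v)%:E.
Proof.
move=> v0; under eq_integral => x _.
  rewrite muleC -nneseriesZl; last by move=> n _; exact: term_ge0.
  over.
rewrite integral_nneseries//=; last 2 first.
- move=> n; apply: emeasurable_funM => //.
  by apply/measurable_EFinP; exact: measurable_L2.
- by move=> n x _; rewrite mule_ge0// lee_fin.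
apply: eq_eseriesr => n _; rewrite EFinM EFin_dot -ge0_integralZl//.
- by apply: eq_integral => x _; rewrite -!EFinM; congr EFin; ring.
- exact: measurable_int (L2_mul_integrable _ _).
- by move=> x _; rewrite lee_fin mulr_ge0.
- by rewrite lee_fin.
Qed.

Lemma integral_series_set (A : Dfin nu) :
  \int[nu]_(x in A) (\sum_(n <oo) (c n * u n x)%:E) =
  \sum_(n <oo) (c n * dot (chi A) (u n))%:E.
Proof.
under [RHS]eq_eseriesr => n _ do rewrite dotC.
rewrite -integral_series_mul; last by move=> x; rewrite /= indicE.
rewrite [LHS]integral_mkcond; apply: eq_integral => x _ /=.
by rewrite patchE/= indicE; case: ifPn; rewrite (mule1, mule0).
Qed.

(** On sets of finite measure [m] agrees with the sum of the measures c_n u_n dnu, hence everywhere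
    by sigma-finiteness. This turns the series for Q(y,A) and P(x,B) into formulas for the integrals
    of non-negative L^2 functions. *)
Lemma integral_measure_of_series (m : {measure set X -> \bar R}) :
  (forall A : Dfin nu, m A = \sum_(n <oo) (c n * dot (chi A) (u n))%:E) ->
  forall v : L2 nu, (forall x, 0 <= v x)%R ->
  \int[m]_x (v x)%:E = \sum_(n <oo) (c n * dot v (u n))%:E.
Proof.
move=> mE v v0.
pose m_ n := mscale (NngNum (c_ge0 n)) (mdensity nu (u n)).
have dE n (w : L2 nu) : (forall x, 0 <= w x)%R ->
    \int[mdensity nu (u n)]_x (w x)%:E = (dot w (u n))%:E.
  move=> w0; rewrite ge0_integral_mdensity//.
  - by rewrite EFin_dot; apply: eq_integral => x _; rewrite ger0_norm ?u_ge0//.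
  - by apply/measurable_EFinP; exact: measurable_L2.
have mE' : forall A, measurable A -> m A = mseries m_ 0 A.
  apply: (@eq_measure_sigma_finite _ _ _ nu m (mseries m_ 0)) => A mA nuA.
  rewrite -[A]/(Dset (MkDfin mA nuA)) mE; apply: eq_eseriesr => n _.
  rewrite EFinM -dE; last by move=> x; rewrite /= indicE.
  by rewrite integral_indic// setIT.
rewrite (eq_measure_integral (mseries m_ 0)); last first.
  by move=> A mA _; exact: mE'.
have mv : measurable_fun setT (EFin \o v).
  by apply/measurable_EFinP; exact: measurable_L2.
rewrite ge0_integral_measure_series//; last by move=> x _; rewrite lee_fin.
apply: eq_eseriesr => n _; rewrite ge0_integral_mscale//.
- by rewrite dE.
- by move=> x _; rewrite lee_fin.
Qed.

End integral_series.

(** * Integrals of L^2 functions against P and Q *)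

Section kernel_values.
Context (R : realType).
Local Open Scope ereal_scope.

Lemma nneseries1 (b : nat -> R) n : (0 <= b n)%R ->
  (forall m, m != n -> b m = 0%R) -> \sum_(i <oo) (b i)%:E = (b n)%:E.
Proof.
move=> bn0 b0; rewrite (nneseriesD1 (n := n))//; last first.
  by move=> i _; rewrite lee_fin; have [->|/b0 ->] := eqVneq i n.
by rewrite eseries0 ?adde0// => i _ /andP[_ /b0 ->].
Qed.

Lemma ae_Dfin d (X : measurableType d)
    (nu : {sigma_finite_measure set X -> \bar R}) (U : X -> Prop) :
  (forall A : Dfin nu, {ae nu, forall x, Dset A x -> U x}) ->
  {ae nu, forall x, U x}.
Proof.
move=> AU; have [F FT mF] := sigma_finiteT nu.
have : {ae nu, forall x, forall n, F n x -> U x}.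
  by apply: ae_foralln => n; have [mFn nuF] := mF n; exact: (AU (MkDfin mFn nuF)).
by apply: filterS => x FU; have [n _ /FU] : (\bigcup_n F n) x by rewrite -FT.
Qed.

Lemma integral_L2_parts d (X : measurableType d)
    (nu m : {measure set X -> \bar R}) (v : L2 nu) (p q : R) :
  \int[m]_x (L2pos v x)%:E = p%:E -> \int[m]_x (L2neg v x)%:E = q%:E ->
  m.-integrable setT (EFin \o v) /\ (p - q)%:E = \int[m]_x (v x)%:E.
Proof.
move=> pE qE.
have int_ge0 (g : L2 nu) r : (forall x, 0 <= g x)%R ->
    \int[m]_x (g x)%:E = r%:E -> m.-integrable setT (EFin \o g).
  move=> g0 gE; apply/integrableP; split.
    by apply/measurable_EFinP; exact: measurable_L2.
  by under eq_integral => x _ do rewrite /= ger0_norm ?g0//; rewrite gE ltry.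
have vE : EFin \o v = (EFin \o L2pos v) \- (EFin \o L2neg v).
  by apply/funext => x /=; rewrite -{1}(L2posBneg v).
have pI := int_ge0 _ _ (L2pos_ge0 v) pE; have qI := int_ge0 _ _ (L2neg_ge0 v) qE.
split; first by rewrite vE; exact: integrableB.
by rewrite -[fun x => _]/(EFin \o v) vE integralB// EFinB -pE -qE.
Qed.

Context d1 (X1 : measurableType d1).
Context (nu1 : {sigma_finite_measure set X1 -> \bar R}).
Context d2 (X2 : measurableType d2).
Context (nu2 : {sigma_finite_measure set X2 -> \bar R}).
Variables (w : nat -> L2 nu1) (phi : nat -> L2 nu2).
Hypothesis w_ge0 : forall n x, (0 <= w n x)%R.
Hypothesis phi_ge0 : forall n y, (0 <= phi n y)%R.

(* With H^+ and H^- the series of the values of P on the parts of g,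
   <T chi_A, g> = <chi_A, h> says that h and H^+ - H^- have the same integral
   over every A of finite measure. *)
Lemma kernel_val_adjoint (P : R.-ker X1 ~> X2) (T : Dfin nu1 -> L2 nu2)
    (g : L2 nu2) (h : L2 nu1) :
  {ae nu1, forall x, forall B : Dfin nu2,
    P x B = \sum_(n <oo) (w n x * dot (chi B) (phi n))%:E} ->
  (forall A, {ae nu2, forall y,
    (T A y)%:E = \sum_(n <oo) (dot (chi A) (w n) * phi n y)%:E}) ->
  (forall A, dot (T A) g = dot (chi A) h) ->
  is_kernel_val P g h.
Proof.
move=> PE TE gh.
(* For [v] >= 0 this is the value of the integral of [v] against P(x, dy), a priori possibly
   infinite. *)
pose H (v : L2 nu2) x := \sum_(n <oo) (dot v (phi n) * w n x)%:E.
have chi0 (A : Dfin nu1) x : (0 <= chi A x)%R by rewrite /= indicE.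
have mH (v : L2 nu2) : (forall y, 0 <= v y)%R -> measurable_fun setT (H v).
  by move=> v0; apply: measurable_series => // n; exact: dot_ge0.
have H_ge0 (v : L2 nu2) x : (forall y, 0 <= v y)%R -> 0 <= H v x.
  by move=> v0; apply: nneseries_ge0 => n _ _; rewrite lee_fin mulr_ge0// dot_ge0.
(* Exchanging sums and integrals on both sides gives the series of <chi_A, w_n><v, phi_n>. As the
   right side is finite, [H v] is integrable over [A], hence finite a.e. there. *)
have intH (v : L2 nu2) (A : Dfin nu1) : (forall y, 0 <= v y)%R ->
    \int[nu1]_(x in A) H v x = (dot (T A) v)%:E.
  move=> v0; rewrite integral_series_set//; last by move=> n; exact: dot_ge0.
  rewrite EFin_dot.
  transitivity (\int[nu2]_y
      ((\sum_(n <oo) (dot (chi A) (w n) * phi n y)%:E) * (v y)%:E)).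
    rewrite integral_series_mul//; last by move=> n; exact: dot_ge0.
    by apply: eq_eseriesr => n _; rewrite mulrC (dotC v).
  apply: ae_eq_integral => //.
  - apply: emeasurable_funM; last by apply/measurable_EFinP; exact: measurable_L2.
    by apply: measurable_series => // n; exact: dot_ge0.
  - exact: measurable_int (L2_mul_integrable _ _).
  - by apply: filterS (TE A) => y TAy _; rewrite EFinM TAy.
have HE : {ae nu1, forall x, exists p q : R,
    [/\ H (L2pos g) x = p%:E, H (L2neg g) x = q%:E & h x = (p - q)%R]}.
  apply: ae_Dfin => A; have mA := Dset_measurable A.
  have HI (v : L2 nu2) : (forall y, 0 <= v y)%R -> nu1.-integrable A (H v).
    move=> v0; apply/integrableP; split; first exact/measurable_funTS/mH.
    by under eq_integral => x _ do rewrite gee0_abs ?H_ge0//; rewrite intH// ltry.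
  have gp := HI _ (L2pos_ge0 g); have gn := HI _ (L2neg_ge0 g).
  have hI : nu1.-integrable A (EFin \o h).
    have := L2_mul_integrable (chi A) h.
    move/(integrableS measurableT mA (@subsetT _ _)); apply: eq_integrable => //.
    by move=> x /[!inE] Ax /=; rewrite indicE mem_set ?mul1r.
  (* Both functions are integrable over [A], so equal integrals over all measurable subsets of [A]
     suffice. *)
  have hE : ae_eq nu1 (Dset A) (EFin \o h) (H (L2pos g) \- H (L2neg g)).
    apply: integral_ae_eq => //.
      apply: emeasurable_funB; apply/measurable_funTS/mH; first exact: L2pos_ge0.
      exact: L2neg_ge0.
    move=> E EA mE.
    have nuE : nu1 E < +oo.
      by apply: le_lt_trans (Dset_fin A); apply: le_measure; rewrite ?inE.
    pose B := MkDfin mE nuE; rewrite -[E]/(Dset B).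
    rewrite -dot_chi -gh -{1}(L2posBneg g) dotBr EFinB -!intH//.
    - by rewrite integralB//; apply: integrableS EA _ => //.
    - exact: L2neg_ge0.
    - exact: L2pos_ge0.
  have := integrable_ae mA gp; have := integrable_ae mA gn.
  apply: filterS3 hE => x hx gnx gpx Ax.
  exists (fine (H (L2pos g) x)), (fine (H (L2neg g) x)).
  have /= hxE := hx Ax; rewrite !fineK ?gnx ?gpx//; split=> //.
  by apply: EFin_inj; rewrite hxE EFinB !fineK ?gnx ?gpx.
apply: filterS2 HE PE => x [p [q [pE qE hx]]] PxE.
have Pv (v : L2 nu2) : (forall y, 0 <= v y)%R -> \int[P x]_y (v y)%:E = H v x.
  move=> v0; rewrite (integral_measure_of_series _ _ PxE)//.
  by apply: eq_eseriesr => n _; rewrite mulrC.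
by rewrite hx; apply: integral_L2_parts;
  rewrite Pv//; [exact: L2pos_ge0|exact: L2neg_ge0].
Qed.

Hypothesis phi_orth : forall m n, dot (phi m) (phi n) = (m == n)%:R.

(* Non-negative orthogonal functions have a.e. disjoint supports, so the series
   defining Q has at most one non-zero term: this is what makes Q(y, .)
   integrate every function of L^2(nu1), with no control on |f| in the form
   domain. *)
Lemma orthogonal_ge0_disjoint :
  {ae nu2, forall y, exists n, forall m, m != n -> phi m y = 0%R}.
Proof.
have : {ae nu2, forall y, forall m n, m != n -> (phi m y * phi n y = 0)%R}.
  apply: ae_foralln => m; apply: ae_foralln => n.
  have [->|mn] := eqVneq m n; first exact: aeW.
  have := EFin_dot (phi m) (phi n); rewrite phi_orth (negbTE mn) => /esym mn0.
  have : \int[nu2]_y `|(phi m y * phi n y)%:E| = 0.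
    rewrite -[RHS]mn0; apply: eq_integral => y _.
    by rewrite gee0_abs// lee_fin mulr_ge0.
  move/ae_eq_integral_abs.
  move=> /(_ measurableT (measurable_int _ (L2_mul_integrable _ _))).
  by apply: filterS => y /= /(_ I) [].
apply: filterS => y disj.
have [[n /eqP n0]|/forallNP all0] :=
    pselect (exists n, phi n y <> 0%R); last first.
  (* All the functions vanish at [y], so the index is arbitrary. *)
  by exists 0%N => m _; apply: contrapT; exact: all0.
exists n => m mn; have /eqP := disj _ _ mn.
by rewrite mulf_eq0 (negbTE n0) orbF => /eqP.
Qed.

(** [G] is the sum of the a_n phi_n, built pointwise. By disjointness of supports its square is a.e.
    the sum of the squares, which integrates term by term. *)
Lemma exists_orthogonal_sum (a : nat -> R) :
  \sum_(n <oo) (a n ^+ 2)%:E < +oo ->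
  exists G : L2 nu2, (dot G G)%:E = \sum_(n <oo) (a n ^+ 2)%:E /\
    forall y n, (forall m, m != n -> phi m y = 0%R) -> G y = (a n * phi n y)%R.
Proof.
move=> a2.
pose S (b : nat -> R) y := \sum_(n <oo) (b n * phi n y)%:E.
(* Positive and negative parts of the coefficients: each then gives a series of non-negative terms,
   measurable in [y]. *)
pose ap n := ((`|a n| + a n) / 2)%R; pose an n := ((`|a n| - a n) / 2)%R.
have ap0 n : (0 <= ap n)%R by rewrite divr_ge0// -lerBlDr sub0r -normrN ler_norm.
have an0 n : (0 <= an n)%R by rewrite divr_ge0// subr_ge0 ler_norm.
pose g y := (fine (S ap y) - fine (S an y))%R.
have mg : measurable_fun setT g.
  apply: measurable_funB; apply: (measurableT_comp (fine_measurable measurableT)).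
    exact: measurable_series.
  exact: measurable_series.
have gE y n : (forall m, m != n -> phi m y = 0%R) -> g y = (a n * phi n y)%R.
  move=> y0; have SE b : (forall n, 0 <= b n)%R -> S b y = (b n * phi n y)%:E.
    move=> b0; apply: (@nneseries1 (fun i => b i * phi i y)%R).
      by rewrite mulr_ge0.
    by move=> m /y0 ->; rewrite mulr0.
  by rewrite /g !SE//= /ap /an; field.
have g2 : \int[nu2]_y (g y ^+ 2)%:E = \sum_(n <oo) (a n ^+ 2)%:E.
  transitivity (\int[nu2]_y (\sum_(n <oo) (a n ^+ 2 * (phi n y * phi n y))%:E)).
    apply: ae_eq_integral => //.
    - by apply/measurable_EFinP; exact: measurable_funX.
    - apply: ge0_emeasurable_sum => [n y _ _|n _].
        by rewrite lee_fin mulr_ge0 ?sqr_ge0// mulr_ge0.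
      apply/measurable_EFinP; apply: measurable_funM => //.
      by apply: measurable_funM; exact: measurable_L2.
    - apply: filterS orthogonal_ge0_disjoint => y [n y0] _.
      rewrite (gE _ _ y0).
      rewrite (@nneseries1 (fun i => a i ^+ 2 * (phi i y * phi i y))%R n).
      + by congr EFin; ring.
      + by rewrite mulr_ge0 ?sqr_ge0// mulr_ge0.
      + by move=> m /y0 ->; rewrite !mulr0.
  rewrite integral_nneseries//; last 2 first.
  - move=> n; apply/measurable_EFinP; apply: measurable_funM => //.
    by apply: measurable_funM; exact: measurable_L2.
  - by move=> n y _; rewrite lee_fin mulr_ge0 ?sqr_ge0// mulr_ge0.
  apply: eq_eseriesr => n _; under eq_integral do rewrite EFinM.
  rewrite ge0_integralZl//.
  - by rewrite -EFin_dot phi_orth eqxx mule1.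
  - exact: measurable_int (L2_mul_integrable _ _).
  - by move=> y _; rewrite lee_fin mulr_ge0.
  - by rewrite lee_fin sqr_ge0.
have gL : g \in Lfun nu2 2%:E.
  rewrite inE; apply/andP; split; rewrite inE//=.
  rewrite /finite_norm unlock /Lnorm; apply: poweR_lty.
  under eq_integral => y _ do
    rewrite /= powR_mulrn// -normrX ger0_norm ?sqr_ge0//.
  by rewrite g2.
exists (Lfun_Sub (lee1n 2) gL); split; last exact: gE.
by rewrite EFin_dot -g2; apply: eq_integral => y _; rewrite expr2.
Qed.

(** For a.e. [y] a single index n survives, and Q(y, dx) is phi_n(y) w_n dnu1. The integral of [f]
    is then phi_n(y) <f, w_n>, with both parts of [f] contributing finite amounts. *)
Lemma kernel_val_orthogonal_sum (Q : R.-ker X2 ~> X1) (f : L2 nu1) (G : L2 nu2) :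
  {ae nu2, forall y, forall A : Dfin nu1,
    Q y A = \sum_(n <oo) (phi n y * dot (chi A) (w n))%:E} ->
  (forall y n, (forall m, m != n -> phi m y = 0%R) ->
    G y = (dot f (w n) * phi n y)%R) ->
  is_kernel_val Q f G.
Proof.
move=> QE GE; apply: filterS2 orthogonal_ge0_disjoint QE => y [n y0] QyE.
have Qv (v : L2 nu1) : (forall x, 0 <= v x)%R ->
    \int[Q y]_x (v x)%:E = (phi n y * dot v (w n))%:E.
  move=> v0; rewrite (integral_measure_of_series _ _ QyE)//.
  apply: (@nneseries1 (fun i => phi i y * dot v (w i))%R).
    by rewrite mulr_ge0// dot_ge0.
  by move=> m /y0 ->; rewrite mul0r.
rewrite (GE _ _ y0) -{2}(L2posBneg f) dotBl mulrBl ![(_ * phi n y)%R]mulrC.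
by apply: integral_L2_parts;
  rewrite Qv//; [exact: L2pos_ge0|exact: L2neg_ge0].
Qed.

End kernel_values.

(** * Parseval's identity in a reproducing kernel Hilbert space *)

Section rkhs_parseval.
Context (R : realType) (D : Type) (K : D -> D -> R).
Variables (H : set (D -> R)) (ip : (D -> R) -> (D -> R) -> R).
Hypothesis Hrkhs : is_rkhs K H ip.
Implicit Types u v w : D -> R.

Let add v w : D -> R := fun x => v x + w x.
Let sub v w : D -> R := fun x => v x - w x.

Let addE v w : add v w = (fun x => 1 * v x + w x).
Proof. by apply/funext => x; rewrite mul1r. Qed.

Let subE v w : sub v w = (fun x => -1 * w x + v x).
Proof. by apply/funext => x; rewrite mulN1r addrC. Qed.

Let H_sub v w : H v -> H w -> H (sub v w).
Proof. by move=> Hv Hw; rewrite subE; apply: (rkhs_lin Hrkhs). Qed.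

Lemma rkhs_add v w : H v -> H w -> H (fun x => v x + w x).
Proof. by move=> Hv Hw; rewrite -/(add v w) addE; apply: (rkhs_lin Hrkhs). Qed.

Lemma rkhs_ip_add v w h : H v -> H w -> H h ->
  ip (fun x => v x + w x) h = ip v h + ip w h.
Proof.
by move=> Hv Hw Hh; rewrite -/(add v w) addE (rkhs_ip_lin Hrkhs)// mul1r.
Qed.

Let ipB v w h : H v -> H w -> H h -> ip (sub v w) h = ip v h - ip w h.
Proof.
by move=> Hv Hw Hh; rewrite subE (rkhs_ip_lin Hrkhs)// mulN1r addrC.
Qed.

Lemma rkhs_ip_addself v w : H v -> H w ->
  ip (fun x => v x + w x) (fun x => v x + w x) = ip v v + 2 * ip v w + ip w w.
Proof.
move=> Hv Hw; have Hvw := rkhs_add Hv Hw.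
rewrite rkhs_ip_add// (rkhs_ipC Hrkhs Hv)// (rkhs_ipC Hrkhs Hw)// !rkhs_ip_add//.
by rewrite (rkhs_ipC Hrkhs Hw Hv); ring.
Qed.

Let ip_subself v w : H v -> H w ->
  ip (sub v w) (sub v w) = ip v v - 2 * ip v w + ip w w.
Proof.
move=> Hv Hw; have Hvw := H_sub Hv Hw.
rewrite ipB// (rkhs_ipC Hrkhs Hv)// (rkhs_ipC Hrkhs Hw)// !ipB//.
by rewrite (rkhs_ipC Hrkhs Hw Hv); ring.
Qed.

Variable k : nat -> D -> R.
Hypothesis k_onb : is_onb_rkhs H ip k.

Let Hk n : H (k n). Proof. by case: k_onb. Qed.

Let ip_k m n : ip (k m) (k n) = (m == n)%:R. Proof. by case: k_onb. Qed.

Let partial (a : nat -> R) N : D -> R := fun x => \sum_(i < N) a i * k i x.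

Let partialS a N : partial a N.+1 = (fun x => a N * k N x + partial a N x).
Proof. by apply/funext => x; rewrite /partial big_ord_recr addrC. Qed.

Let partial0 a : partial a 0 = (fun=> 0).
Proof. by apply/funext => x; rewrite /partial big_ord0. Qed.

Let H_partial a N : H (partial a N).
Proof.
elim: N => [|N IH]; first by rewrite partial0; exact: rkhs_0 Hrkhs.
by rewrite partialS; exact: (rkhs_lin Hrkhs).
Qed.

Let ip0 v : H v -> ip (fun=> 0) v = 0.
Proof.
move=> Hv; have -> : (fun=> 0) = sub v v by apply/funext => x; rewrite /sub subrr.
by rewrite ipB// subrr.
Qed.

Let ip_partial a N v : H v -> ip (partial a N) v = \sum_(i < N) a i * ip (k i) v.
Proof.
move=> Hv; elim: N => [|N IH]; first by rewrite partial0 big_ord0 ip0.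
by rewrite partialS (rkhs_ip_lin Hrkhs)// IH big_ord_recr addrC.
Qed.

Let ip_partial_k a N n : ip (partial a N) (k n) = if (n < N)%N then a n else 0.
Proof.
rewrite ip_partial//; case: ltnP => nN.
  rewrite (bigD1 (Ordinal nN))//= ip_k eqxx mulr1 big1 ?addr0// => i.
  by rewrite -val_eqE ip_k/= => /negbTE ->; rewrite mulr0.
rewrite big1// => i _; rewrite ip_k; case: eqP => [in_|_]; last by rewrite mulr0.
by have := ltn_ord i; rewrite in_ ltnNge nN.
Qed.

Let ip_partial_partial a m n : (n <= m)%N ->
  ip (partial a m) (partial a n) = \sum_(i < n) a i ^+ 2.
Proof.
move=> nm; rewrite (rkhs_ipC Hrkhs)// ip_partial//; apply: eq_bigr => i _.
by rewrite (rkhs_ipC Hrkhs)// ip_partial_k (leq_trans (ltn_ord i) nm).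
Qed.

(** Cauchy-Schwarz against the unit vector k_n: expand |v - t k_n|^2 >= 0 at t = <v, k_n>. *)
Let ip_k_sqr v n : H v -> ip v (k n) ^+ 2 <= ip v v.
Proof.
move=> Hv; pose t := ip v (k n).
(* The added zero brings the multiple of k_n into the form a f + g of [rkhs_lin]. *)
have Htk : H (fun x => t * k n x + 0).
  by apply: (rkhs_lin Hrkhs) => //; exact: rkhs_0 Hrkhs.
have tkE w : H w -> ip (fun x => t * k n x + 0) w = t * ip (k n) w.
  move=> Hw; rewrite (rkhs_ip_lin Hrkhs)//; first by rewrite ip0 ?addr0.
  exact: rkhs_0 Hrkhs.
have := rkhs_ip_ge0 Hrkhs (H_sub Hv Htk).
rewrite ip_subself// (rkhs_ipC Hrkhs Hv)// !tkE// (rkhs_ipC Hrkhs _ Htk)// tkE//.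
rewrite ip_k eqxx mulr1 (rkhs_ipC Hrkhs (Hk n) Hv) -/t; nra.
Qed.

(** The Fourier partial sums of [v] are Cauchy, since their squared norms increase and are bounded
    by |v|^2. Their limit has the coefficients of [v], so it is [v] by totality of the basis, and
    the squared norms converge to |v|^2. *)
Lemma rkhs_parseval v : H v ->
  (fun N => \sum_(i < N) ip v (k i) ^+ 2) @ \oo --> ip v v.
Proof.
move=> Hv; pose a i := ip v (k i); pose S N := \sum_(i < N) a i ^+ 2.
have ip_v_partial N : ip v (partial a N) = S N.
  rewrite (rkhs_ipC Hrkhs)// ip_partial//; apply: eq_bigr => i _.
  by rewrite (rkhs_ipC Hrkhs)//.
(* Pythagoras for the remainder; its non-negativity is Bessel's inequality. *)
have ip_rest N : ip (sub (partial a N) v) (sub (partial a N) v) = ip v v - S N.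
  rewrite ip_subself// (rkhs_ipC Hrkhs _ Hv)// ip_v_partial ip_partial_partial//.
  by rewrite -/(S N); ring.
have S_nd : {homo S : m n / (m <= n)%N >-> m <= n}.
  apply/nondecreasing_seqP => n; rewrite /S big_ord_recr lerDl sqr_ge0//.
have S_ub N : S N <= ip v v.
  by rewrite -subr_ge0 -ip_rest; apply: (rkhs_ip_ge0 Hrkhs); exact: H_sub.
have S_cvg : cvgn S.
  by apply: nondecreasing_is_cvgn => //; exists (ip v v) => _ [N _ <-].
have [u Hu cvg_u] : exists2 u, H u &
    (fun n => ip (sub (partial a n) u) (sub (partial a n) u)) @ \oo --> (0 : R).
  apply: (rkhs_complete Hrkhs) => // e e0.
  have /cvgrPdist_lt /(_ e e0) [N _ SN] := S_cvg.
  have SB m n : (N <= n)%N -> S m - S n < e.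
    move=> Nn; have := SN n Nn; have := nondecreasing_cvgn_le S_nd S_cvg m.
    by rewrite ltr_norml => Sm /andP[_]; apply: le_lt_trans; rewrite lerB.
  exists N => m n Nm Nn; rewrite -/(sub (partial a m) (partial a n)) ip_subself//.
  wlog nm : m n Nm Nn / (n <= m)%N => [wl|].
    have /orP[/wl|/wl] := leq_total n m; first exact.
    rewrite (rkhs_ipC Hrkhs (H_partial a m))// => /(_ Nn Nm); apply: le_lt_trans.
    by rewrite addrAC [leRHS]addrAC lerD2r addrC.
  rewrite !ip_partial_partial// -/(S _) -/(S _) (le_lt_trans _ (SB m n Nn))//.
  by rewrite le_eqVlt; apply/orP; left; apply/eqP; ring.
have vu : v = u.
  have Huv := H_sub Hv Hu.
  suff : sub v u = (fun=> 0).
    move=> vu0; apply/funext => x; apply/eqP.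
    by rewrite -subr_eq0 -/(sub v u x) vu0.
  case: k_onb => _ _; apply => // n; apply/eqP.
  rewrite -sqrf_eq0 eq_le sqr_ge0 andbT leNgt; apply/negP => t0.
  (* At least n + 1 terms are taken, so that the partial sum has the n-th coefficient of [v]. Then
     <v - u, k_n> is also a coefficient of the small vector [z], whose squared norm is below its
     square: a contradiction. *)
  have /cvgrPdist_lt /(_ _ t0) [N _ /(_ (maxn N n.+1))] := cvg_u.
  rewrite /= leq_maxl => /(_ isT); set z := sub _ u.
  have Hz : H z by exact: H_sub.
  have -> : ip (sub v u) (k n) = ip z (k n).
    by rewrite !ipB// ip_partial_k leq_max ltnSn orbT.
  rewrite sub0r normrN ger0_norm; last exact: (rkhs_ip_ge0 Hrkhs).
  by rewrite ltNge ip_k_sqr.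
move: cvg_u; rewrite -vu => cvg_v.
have : (fun n => ip v v - ip (sub (partial a n) v) (sub (partial a n) v))
    @ \oo --> ip v v - 0.
  by apply: cvgB => //; exact: cvg_cst.
rewrite subr0 (_ : (fun n => _) = S)//; apply/funext => n.
by rewrite ip_rest opprB addrC subrK.
Qed.

End rkhs_parseval.

(** * The Friedrichs extension *)

Section friedrichs_theory.
Context (R : realType) d (X : measurableType d).
Context (mu : {measure set X -> \bar R}) (T : L2op mu mu).

(** By symmetry [T f] is an adjoint value at [f], and the constant sequence [f] shows that [f] lies
    in the form domain. *)
Lemma friedrichs_extends f : is_linear_op T -> densely_defined T ->
  symmetric_op T -> dom T f ->
  dom (friedrichs T) f /\ friedrichs T f = T f %[ae mu].
Proof.
move=> [_ _ Tlin] Td Tsym Tf.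
have adjf : is_adjoint_val T f (T f) by move=> g Tg; exact: Tsym.
split; last exact: adjointE.
split; first by exists (T f).
exists (fun=> f); split=> // [|e e0].
  by under eq_fun do rewrite subrr dot0l; exact: cvg_cst.
by exists 0%N => m n _ _; rewrite subrr dotC dot0l.
Qed.

Lemma Fspan_chi (A : Dfin mu) : Fspan mu (chi A).
Proof. by exists 1%N, (fun=> 1), (fun=> A); rewrite big_ord1 scale1r. Qed.

Lemma hatD f g : hat T (f + g) = (fun A => hat T f A + hat T g A).
Proof. by apply/funext => A; rewrite /hat dotDr. Qed.

End friedrichs_theory.

Lemma EFin_cvg_eseries (R : realType) (a : nat -> R) (l : R) :
  (fun N => \sum_(i < N) a i) @ \oo --> l -> (\sum_(n <oo) (a n)%:E = l%:E)%E.
Proof.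
move=> al; apply: cvg_lim => //; apply: cvg_EFin.
  by apply: nearW => N; rewrite sumEFin.
apply: cvg_trans al; apply: near_eq_cvg; apply: nearW => N.
by rewrite /= sumEFin big_mkord.
Qed.

(** * The factorization of the Friedrichs extension *)

Theorem theorem7p12 (R : realType)
    (d1 : measure_display) (X1 : measurableType d1)
    (nu1 : {sigma_finite_measure set X1 -> \bar R})
    (d2 : measure_display) (X2 : measurableType d2)
    (nu2 : {sigma_finite_measure set X2 -> \bar R})
    (std1 : standard_borel R X1) (std2 : standard_borel R X2)
    (* the operator R, assumptions (i)-(iv) *)
    (Rop : L2op nu1 nu1)
    (Rlin : is_linear_op Rop) (Rdense : densely_defined Rop)
    (RF : Fspan nu1 `<=` dom Rop)
    (Rsym : symmetric_op Rop) (Rpos : nonneg_preserving Rop)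
    (Rpd : positive_definite_op Rop) (Rker : trivial_kernel Rop)
    (* the square root of its Friedrichs extension *)
    (Rhalf : L2op nu1 nu1) (Rhalf_sqrt : is_sqrt_op Rhalf (friedrichs Rop))
    (* the symmetric measure lambda_1 and its RKHS (H, ip) *)
    (lambda1 : {measure set (X1 * X1)%type -> \bar R})
    (lambda1E : forall A B : Dfin nu1,
       lambda1 (A `*` B) = (dot (chi A) (Rop (chi B)))%:E)
    (lambda1_sym : forall A B : set X1, measurable A -> measurable B ->
       lambda1 (A `*` B) = lambda1 (B `*` A))
    (H : set (Dfin nu1 -> R)) (ip : (Dfin nu1 -> R) -> (Dfin nu1 -> R) -> R)
    (Hrkhs : is_rkhs (fun A B : Dfin nu1 => fine (lambda1 (A `*` B))) H ip)
    (Hhat : forall f, dom Rhalf f ->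
       H (hat Rop f) /\
       ip (hat Rop f) (hat Rop f) = dot (Rhalf f) (Rhalf f))
    (* the two orthonormal bases *)
    (k : nat -> Dfin nu1 -> R) (k_onb : is_onb_rkhs H ip k)
    (f : nat -> L2 nu1)
    (f_half : forall n, dom Rhalf (f n)) (f_dom : forall n, dom Rop (f n))
    (kE : forall n A, k n A = hat Rop (f n) A)
    (phi : nat -> L2 nu2) (phi_onb : is_onb_L2 phi)
    (f_ge0 : forall n, ae_nonneg (f n)) (phi_ge0 : forall n, ae_nonneg (phi n))
    (* the kernels Q and P *)
    (Q : R.-ker X2 ~> X1)
    (QE : {ae nu2, forall y, forall A : Dfin nu1,
       Q y A = (\sum_(n <oo) (k n A * phi n y)%:E)%E})
    (P : R.-ker X1 ~> X2)
    (PE : {ae nu1, forall x, forall B : Dfin nu2,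
       P x B = (\sum_(n <oo) (Rintegral nu2 B (phi n) * Rop (f n) x)%:E)%E})
    (Qdom : Fspan nu1 `<=` dom (kernel_op nu1 nu2 Q))
    (Pdom : Fspan nu2 `<=` dom (kernel_op nu2 nu1 P)) :
  op_eq (friedrichs Rop) (op_comp (T_P nu2 Rhalf Q P) (T_Q nu2 Rhalf Q)).
Proof.
have [Ssa _ [dSS SSE]] := Rhalf_sqrt.
pose S := Rhalf; pose B := T_Q nu2 S Q.
have R_S g : dom Rop g ->
    [/\ dom S g, dom S (S g) & S (S g) = Rop g %[ae nu1]].
  move=> Rg; have [Fg FgE] := friedrichs_extends Rlin Rdense Rsym Rg.
  have [Sg SSg] : dom (op_comp S S) g by rewrite dSS.
  by split=> //; apply: ae_eq_trans FgE; exact: SSE.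
have S_chi A : dom S (chi A) by have [] := R_S _ (RF _ (Fspan_chi A)).
(* Everywhere non-negative representatives of R(f_n) and phi_n; R(f_n) >= 0 a.e. because R preserves
   non-negativity. *)
pose w n := L2pos (Rop (f n)); pose psi n := L2pos (phi n).
have wE n : w n = Rop (f n) %[ae nu1] by apply: L2pos_id; exact: Rpos.
have psiE n : psi n = phi n %[ae nu2] by exact: L2pos_id.
have w_ge0 n x : 0 <= w n x by exact: L2pos_ge0.
have psi_ge0 n y : 0 <= psi n y by exact: L2pos_ge0.
have psi_orth m n : dot (psi m) (psi n) = (m == n)%:R.
  by rewrite (eq_dotl _ (psiE m)) (eq_dotr _ (psiE n)); case: phi_onb.
have kwE n A : k n A = dot (chi A) (w n).
  rewrite kE /hat Rsym//; last exact/RF/Fspan_chi.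
  by apply: eq_dotr; apply: ae_eq_sym; exact: wE.
have kfE n : k n = hat Rop (f n) by apply/funext => A; exact: kE.
have QE' : {ae nu2, forall y, forall A : Dfin nu1,
    Q y A = (\sum_(n <oo) (psi n y * dot (chi A) (w n))%:E)%E}.
  have := ae_foralln psiE; apply: filterS2 QE => y QyE psiyE A.
  by rewrite QyE; apply: eq_eseriesr => n _; rewrite kwE psiyE// mulrC.
have PE' : {ae nu1, forall x, forall A : Dfin nu2,
    P x A = (\sum_(n <oo) (w n x * dot (chi A) (psi n))%:E)%E}.
  have := ae_foralln wE; apply: filterS2 PE => x PxE wxE A.
  rewrite PxE; apply: eq_eseriesr => n _; rewrite wxE// mulrC; congr (_ * _)%:E.
  by rewrite (eq_dotr _ (psiE n)) /Rintegral -dot_chi.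
(* Polarization of the norm identity [Hhat]. *)
have ip_hat g h : dom S g -> dom S h ->
    ip (hat Rop g) (hat Rop h) = dot (S g) (S h).
  move=> Sg Sh; have [Sgh _] := self_adjointD Ssa Sg Sh.
  have [Hg ipg] := Hhat _ Sg; have [Hh iph] := Hhat _ Sh; have [_] := Hhat _ Sgh.
  rewrite hatD (rkhs_ip_addself Hrkhs)// (self_adjoint_dotD Ssa)// ipg iph.
  by lra.
(* Since R(f_n) = S S f_n, moving one factor S across gives <g, w_n> = <S g, S f_n>. *)
have coefE g n : dom S g -> dot g (w n) = ip (hat Rop g) (k n).
  move=> Sg; have [Sf SSf SSfE] := R_S _ (f_dom n).
  rewrite kfE ip_hat// (self_adjoint_dot Ssa)//; apply: eq_dotr.
  by apply: ae_eq_trans (wE n) _; exact: ae_eq_sym.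
have B_exists g : dom S g -> exists G : L2 nu2,
    is_kernel_val Q g G /\ dot G G = dot (S g) (S g).
  move=> Sg; have [Hg ipg] := Hhat _ Sg.
  have sumE : (\sum_(n <oo) (dot g (w n) ^+ 2)%:E = (dot (S g) (S g))%:E)%E.
    rewrite -ipg; apply: EFin_cvg_eseries.
    under eq_fun do under eq_bigr do rewrite coefE//.
    exact: (rkhs_parseval Hrkhs k_onb).
  have [|G [GG GE]] := exists_orthogonal_sum psi_ge0 psi_orth
      (a := fun n => dot g (w n)).
    by rewrite sumE ltry.
  exists G; split; last by apply: EFin_inj; rewrite GG.
  exact: (kernel_val_orthogonal_sum w_ge0 psi_ge0 psi_orth QE' GE).
have B_val g : dom S g -> is_kernel_val Q g (B g).
  by move=> /B_exists[G [GQ _]]; apply: kernel_opP; exists G.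
have B_dom g : dom S g -> dom B g.
  by move=> Sg; split=> //; have [G [GQ _]] := B_exists _ Sg; exists G.
have B_self g : dom S g -> dot (B g) (B g) = dot (S g) (S g).
  move=> Sg; have [G [GQ <-]] := B_exists _ Sg.
  have BG := is_kernel_val_inj (B_val _ Sg) GQ.
  by rewrite (eq_dotl _ BG) (eq_dotr _ BG).
(* Polarization again, now by additivity of the kernel integrals. *)
have B_dot g h : dom S g -> dom S h -> dot (B g) (B h) = dot (S g) (S h).
  move=> Sg Sh; have [Sgh _] := self_adjointD Ssa Sg Sh.
  have BD := kernel_opE (is_kernel_valD (B_val _ Sg) (B_val _ Sh)).
  have := B_self _ Sgh; rewrite (self_adjoint_dotD Ssa)//.
  rewrite (eq_dotl _ BD) (eq_dotr _ BD) dotDl !dotDr (dotC (B h) (B g)).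
  by rewrite !B_self//; lra.
have B_chi A : {ae nu2, forall y,
    (B (chi A) y)%:E = (\sum_(n <oo) (dot (chi A) (w n) * psi n y)%:E)%E}.
  have := B_val _ (S_chi A); apply: filterS2 QE' => y QyE [_ ->].
  rewrite integral_indic ?setIT//; last exact: Dset_measurable.
  by rewrite QyE; apply: eq_eseriesr => n _; rewrite mulrC.
(* Every value of the adjoint of T_Q is thus a kernel integral against P, so T_P is that adjoint.
   Testing against indicators suffices. *)
have P_val g h : is_adjoint_val B g h -> is_kernel_val P g h.
  move=> gh; apply: (kernel_val_adjoint w_ge0 psi_ge0 PE' B_chi) => A.
  exact/gh/B_dom.
have adj_B g : dom S g -> dom S (S g) -> is_adjoint_val B (B g) (S (S g)).
  by move=> Sg SSg h [_ Sh]; rewrite B_dot// (self_adjoint_dot Ssa).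
split.
  rewrite -dSS; apply/seteqP; split=> [g [Sg SSg]|g [[_ Sg] [_ [h gh]]]].
    split; first exact: B_dom.
    split; last by exists (S (S g)); exact: adj_B.
    by exists (S (S g)); apply: P_val; exact: adj_B.
  (* An adjoint value [h] of T_Q at T_Q g gives <S u, S g> = <T_Q u, T_Q g> = <u, h> for all [u] in
     [dom S], which forces [S g] into [dom S]. *)
  split=> //; have [] // := @self_adjointP _ _ _ _ _ Ssa (S g) h.
  by move=> u Su; rewrite -gh; [rewrite B_dot|exact: B_dom].
rewrite -dSS => g SSg; apply: (ae_eq_trans (g := S (S g))).
  by apply: ae_eq_sym; exact: SSE.
apply: ae_eq_sym; apply: kernel_opE; apply: P_val.
by case: SSg => Sg SSg; exact: adj_B.
Qed.
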